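(* Let $K$ be a field of characteristic $0$, and let $a(k),b(k)\in K[k]$ be nonzero polynomials such that \[ a(k) = b(k+\alpha) \quad\text{and}\quad b(\beta+k) = \pm b(\beta-k) \] (for one of the two choices of sign, as identities in $K[k]$) for some $\alpha,\beta\in K$. Assume further that $-(\alpha+1)\deg a(k)\notin\mathbb{N}$. Put \[ \gamma = -\beta + \frac{\alpha-1}{2}. \] Then for any non-negative integer $m$, we have \[ [(k+\gamma)^{2m}] \in \left\langle [(k+\gamma)^{2i}] \colon 0\le 2i < \deg a(k) - 1 \right\rangle \] and \[ [(k+\gamma)^{2m+1}] \in \left\langle [(k+\gamma)^{2i+1}] \colon 0\le 2i+1 < \deg a(k) - 1 \right\rangle . \]
   Context: $\mathbb{N}$ denotes the set of nonnegative integers, regarded as a subset of $K$. For $a(k),b(k)\in K[k]$, the difference space corresponding to $a(k)$ and $b(k)$ is the $K$-linear subspace \[ S_{a,b} = \{a(k)x(k+1) - b(k-1)x(k) \colon x(k)\in K[k]\} \] of $K[k]$. For a polynomial $p(k)$, $[p(k)] = p(k)+S_{a,b}$ denotes its coset in the quotient vector space $K[k]/S_{a,b}$, and $\langle\cdots\rangle$ denotes the $K$-linear span in $K[k]/S_{a,b}$ (the index $i$ ranges over integers satisfying the displayed inequalities). *)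

(* Defs.v *)
From HB Require Import structures.
From mathcomp Require Import all_boot all_algebra.
From mathcomp Require Import boolp classical_sets.

Set Implicit Arguments.
Unset Strict Implicit.
Unset Printing Implicit Defensive.

Import GRing.Theory.
Local Open Scope ring_scope.
Local Open Scope quotient_scope.
Local Open Scope classical_set_scope.

Definition lspan (R : nzRingType) (V : lmodType R) (A : set V) : set V :=
  [set v | exists (n : nat) (c : 'I_n -> R) (u : 'I_n -> V),
     (forall i, A (u i)) /\ v = \sum_(i < n) c i *: u i].

Section DifferenceSpace.
Variables (K : fieldType) (a b : {poly K}).

Definition diff_op (x : {poly K}) : {poly K} :=
  a * (x \Po ('X + 1)) - (b \Po ('X - 1)) * x.

Definition diff_space : set {poly K} := range diff_op.

(* MathComp takes quotients by boolean predicates, hence the classical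
   membership test; it only provides the additive structure of the quotient,
   so the scalar multiplication is added below. *)
Definition in_diff_space (p : {poly K}) : bool := p \in diff_space.

Fact in_diff_space_submod : submod_closed in_diff_space.
Proof.
split=> [|c p q].
  by apply/mem_set; exists 0 => //; rewrite /diff_op comp_poly0 !mulr0 subr0.
move=> /set_mem[x _ <-] /set_mem[y _ <-].
apply/mem_set; exists (c *: x + y) => //; rewrite /diff_op.
rewrite comp_polyD comp_polyZ !mulrDr -!scalerAr scalerBr opprD.
by rewrite addrACA.
Qed.

HB.instance Definition _ := GRing.isSubmodClosed.Build K {poly K}
  in_diff_space in_diff_space_submod.

Definition diff_zmod := GRing.ZmodClosed.clone {poly K} in_diff_space _.

Definition diff_quot : Type := Quotient.quot diff_zmod.

HB.instance Definition _ := GRing.Zmodule.on diff_quot.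

Definition coset (p : {poly K}) : diff_quot :=
  \pi_(Quotient.quot diff_zmod) p.

Lemma coset_eqP (p q : {poly K}) : coset p = coset q <-> diff_space (p - q).
Proof.
split=> [/eqP|dS_pq]; first by rewrite -Quotient.idealrBE => /set_mem.
by apply/eqP; rewrite -Quotient.idealrBE; apply/mem_set.
Qed.

Fact cosetD (p q : {poly K}) : coset (p + q) = coset p + coset q.
Proof. exact: (raddfD \pi_(Quotient.quot diff_zmod)). Qed.

Definition coset_scale (c : K) (x : diff_quot) : diff_quot :=
  coset (c *: repr x).

Fact cosetZ (c : K) (p : {poly K}) : coset (c *: p) = coset_scale c (coset p).
Proof.
apply/coset_eqP/set_mem; rewrite -scalerBr -[_ \in _]/(_ \in in_diff_space).
apply: rpredZ; apply/mem_set/coset_eqP.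
by rewrite /coset reprK.
Qed.

Fact coset_ind (P : diff_quot -> Prop) :
  (forall p, P (coset p)) -> forall x, P x.
Proof. exact: quotW. Qed.

Fact coset_scaleA c d x :
  coset_scale c (coset_scale d x) = coset_scale (c * d) x.
Proof. by elim/coset_ind: x => p; rewrite -!cosetZ scalerA. Qed.

Fact coset_scale1 : left_id 1 coset_scale.
Proof. by elim/coset_ind=> p; rewrite -cosetZ scale1r. Qed.

Fact coset_scaleDr : right_distributive coset_scale +%R.
Proof.
move=> c; elim/coset_ind=> p; elim/coset_ind=> q.
by rewrite -cosetD -!cosetZ scalerDr cosetD.
Qed.

Fact coset_scaleDl x : {morph coset_scale^~ x : c d / c + d}.
Proof. by elim/coset_ind: x => p c d; rewrite -!cosetZ scalerDl cosetD. Qed.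

HB.instance Definition _ := GRing.Zmodule_isLmodule.Build K diff_quot
  coset_scaleA coset_scale1 coset_scaleDr coset_scaleDl.

Fact coset_is_linear : linear coset.
Proof. by move=> c p q; rewrite cosetD cosetZ. Qed.

HB.instance Definition _ := GRing.isLinear.Build K {poly K} diff_quot
  *:%R coset coset_is_linear.

End DifferenceSpace.

(* Main.v *)
Require Import Defs.
From mathcomp Require Import all_boot all_algebra.
From mathcomp Require Import boolp classical_sets.
From mathcomp Require Import ring zify.

(** In the centred variable [t = k + gamma] the difference operator becomes
    odd-symmetric.  Write [h(u) = b(beta + u)], so that [h(-u) = e h(u)] with
    [e = 1] or [e = -1], and [delta = (alpha + 1) / 2].  The value of [gamma] is
    the one for which [a(k) = h(t + delta)] and [b(k - 1) = h(t - delta)].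
    Applied to [x(k) = (t - 1/2)^n], the operator therefore gives
<<
      L_n(t) = h(t + delta) (t + 1/2)^n - h(t - delta) (t - 1/2)^n,
>>
    and replacing [t] by [-t] exchanges the two products up to sign: [L_n] is an
    even or an odd polynomial in [t] ([coef_centered_diff_parity]).

    With [d] the degree of [a], the two products have the same leading term,
    and the coefficient of [t^(d + n - 1)] in [L_n] is
    [((alpha + 1) d + n) lead_coef b] ([centered_diff_top]).  The hypothesis on
    [alpha] says precisely that it never vanishes, and it forces [d > 0].  Hence
    for each [N >= d - 1] the difference space contains a polynomial of exact
    degree [N] in [t] all of whose monomials have the parity of [N].  It rewrites
    [t^N] modulo the difference space in terms of lower powers of the same
    parity, and strong induction on [N] concludes
    ([monomial_parity_reduction]). *)

Import GRing.Theory.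
Local Open Scope ring_scope.
Local Open Scope classical_set_scope.

(** * Linear spans *)

Section LinearSpan.
Context {R : nzRingType} {V : lmodType R}.
Implicit Types A B : set V.

Lemma lspan_sub A B v : A `<=` B -> lspan A v -> lspan B v.
Proof.
by move=> sAB [n [c [u [Au ->]]]]; exists n, c, u; split=> // i; apply: sAB.
Qed.

Lemma lspan_gen A v : A v -> lspan A v.
Proof.
move=> Av; exists 1%N, (fun=> 1), (fun=> v); split=> //.
by rewrite big_ord1 scale1r.
Qed.

Lemma lspan0 A : lspan A 0.
Proof.
by exists 0%N, (fun=> 0), (fun=> 0); split; [case | rewrite big_ord0].
Qed.

Lemma lspanZ A c v : lspan A v -> lspan A (c *: v).
Proof.
move=> [n [d [u [Au ->]]]]; exists n, (fun i => c * d i), u; split=> //.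
by rewrite scaler_sumr; apply: eq_bigr => i _; rewrite scalerA.
Qed.

Lemma lspanD A v w : lspan A v -> lspan A w -> lspan A (v + w).
Proof.
move=> [n1 [c1 [u1 [Au1 ->]]]] [n2 [c2 [u2 [Au2 ->]]]].
pose glue T (f1 : 'I_n1 -> T) (f2 : 'I_n2 -> T) (i : 'I_(n1 + n2)) :=
  match split i with inl j => f1 j | inr j => f2 j end.
exists (n1 + n2)%N, (glue _ c1 c2), (glue _ u1 u2); split.
  by move=> i; rewrite /glue; case: (split i).
rewrite big_split_ord /=; congr (_ + _); apply: eq_bigr => i _; rewrite /glue.
  by rewrite -[lshift _ _]/(unsplit (inl i)) unsplitK.
by rewrite -[rshift _ _]/(unsplit (inr i)) unsplitK.
Qed.

Lemma lspan_sum A (I : finType) (F : I -> V) :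
  (forall i, lspan A (F i)) -> lspan A (\sum_i F i).
Proof.
by move=> AF; apply: big_ind => //; [apply: lspan0 | apply: lspanD].
Qed.

End LinearSpan.

(** [f] is meant to be a map to a quotient: the polynomials in its kernel act as
    rewriting rules for monomials.  As each rule involves a single parity, the
    rewriting of ['X^N] never leaves the parity of [N]. *)
Lemma monomial_parity_reduction (K : fieldType) (V : lmodType K)
    (f : {linear {poly K} -> V}) (D : nat) :
  (forall N, (D <= N)%N -> exists q : {poly K},
     [/\ f q = 0, (size q <= N.+1)%N, q`_N != 0 &
         forall j, odd j != odd N -> q`_j = 0]) ->
  forall N, lspan [set f 'X^j | j in [set j | (j < D)%N && (odd j == odd N)]]
                  (f 'X^N).
Proof.
move=> rule; elim/ltn_ind=> N IHN.
have [ltND|leDN] := ltnP N D.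
  by apply: lspan_gen; exists N => //=; rewrite ltND eqxx.
have [q [fq0 szq qN q_par]] := rule N leDN.
have fE : f q = \sum_(i < N.+1) q`_i *: f 'X^i.
  rewrite -{1}(coefK q) poly_def (big_ord_widen _ (fun i => q`_i *: 'X^i) szq).
  rewrite big_mkcond linear_sum; apply: eq_bigr => i _ /=.
  case: ifP => [_|/negbT]; first by rewrite linearZ.
  by rewrite -leqNgt => szqi; rewrite nth_default // scale0r linear0.
have -> : f 'X^N = - (q`_N)^-1 *: \sum_(i < N) q`_i *: f 'X^i.
  move: fE; rewrite fq0 big_ord_recr /= => /esym/(canRL (addrK _)) ->.
  by rewrite add0r scalerN scaleNr opprK scalerA mulVf // scale1r.
apply/lspanZ/lspan_sum => i.
have [odd_i|/q_par->] := eqVneq (odd i) (odd N); last first.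
  by rewrite scale0r; apply: lspan0.
by apply: lspanZ; rewrite -odd_i; apply: IHN.
Qed.

(** * Coefficients of translated and reflected polynomials *)

Lemma coef_XaddC_exp (R : comNzRingType) (c : R) i j :
  (('X + c%:P) ^+ i)`_j = c ^+ (i - j) *+ 'C(i, j).
Proof.
have -> : ('X + c%:P) ^+ i = \poly_(k < i.+1) (c ^+ (i - k) *+ 'C(i, k)).
  rewrite addrC exprDn poly_def; apply: eq_bigr => k _.
  by rewrite -polyC_exp mul_polyC scalerMnl.
by rewrite coef_poly ltnS; case: leqP => // /bin_small ->.
Qed.

Lemma coef_comp_XaddC (R : comNzRingType) (p : {poly R}) (c : R) n j :
  (size p <= n)%N ->
  (p \Po ('X + c%:P))`_j = \sum_(i < n) p`_i * (c ^+ (i - j) *+ 'C(i, j)).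
Proof.
move=> szp; rewrite coef_comp_poly.
rewrite (big_ord_widen _ (fun i => p`_i * (('X + c%:P) ^+ i)`_j) szp).
rewrite big_mkcond.
apply: eq_bigr => i _ /=; rewrite coef_XaddC_exp.
by case: ltnP => // szpi; rewrite nth_default // mul0r.
Qed.

Lemma coef_comp_XaddC_top (R : comNzRingType) (p : {poly R}) (c : R) n :
  (size p <= n.+1)%N -> (p \Po ('X + c%:P))`_n = p`_n.
Proof.
move=> szp; rewrite (coef_comp_XaddC _ _ _ _ _ szp) big_ord_recr /=.
rewrite big1 => [|i _].
  by rewrite add0r subnn binn mulr1.
by rewrite bin_small // mulr0.
Qed.

Lemma coef_comp_XaddC_subtop (R : comNzRingType) (p : {poly R}) (c : R) n :
  (size p <= n.+2)%N ->
  (p \Po ('X + c%:P))`_n = p`_n + p`_n.+1 * (c *+ n.+1).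
Proof.
move=> szp; rewrite (coef_comp_XaddC _ _ _ _ _ szp) !big_ord_recr /=.
rewrite big1 => [|i _].
  by rewrite add0r subnn binn mulr1 subSnn expr1 binSn.
by rewrite bin_small // mulr0.
Qed.

Lemma size_comp_XaddC (R : comNzRingType) (p : {poly R}) (c : R) n :
  (size p <= n)%N -> (size (p \Po ('X + c%:P)) <= n)%N.
Proof.
move=> szp; apply/leq_sizeP => j lenj.
rewrite (coef_comp_XaddC _ _ _ _ _ szp) big1 // => i _.
by rewrite bin_small ?mulr0 // (leq_trans (ltn_ord i)).
Qed.

(** The leading terms of the two translates cancel, and the even-order terms of
    their Taylor expansions as well, so that to leading order the difference is
    [2 c p'].  When [n = 0] it vanishes, and the index [n.-1 = 0] is harmless. *)
Lemma central_difference (R : comNzRingType) (p : {poly R}) (c : R) n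
    (D := (p \Po ('X + c%:P)) - (p \Po ('X + (- c)%:P))) :
  (size p <= n.+1)%N -> (size D <= n)%N /\ D`_n.-1 = p`_n * (2 * c * n%:R).
Proof.
move=> szp.
have szD : (size D <= n)%N.
  apply/leq_sizeP => j; rewrite leq_eqVlt /D coefB => /predU1P[<-|ltnj].
    by rewrite !coef_comp_XaddC_top ?subrr.
  by rewrite !nth_default ?subrr // (leq_trans (size_comp_XaddC _ _ _ _ szp)).
split=> //; case: n szp szD => [|n] szp szD.
  by rewrite nth_default ?mulr0 // (leq_trans szD).
rewrite /D coefB !coef_comp_XaddC_subtop //.
by rewrite -(mulr_natr c) -(mulr_natr (- c)) /=; ring.
Qed.

Lemma coefM_top (R : nzRingType) (p q : {poly R}) m n :
  (size p <= m.+1)%N -> (size q <= n.+1)%N -> (p * q)`_(m + n) = p`_m * q`_n.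
Proof.
move=> szp szq; have ltm : (m < (m + n).+1)%N by rewrite ltnS leq_addr.
rewrite coefM (bigD1 (Ordinal ltm)) //= addKn big1 ?addr0 // => i.
rewrite -val_eqE /= neq_ltn => /orP[lt_im|lt_mi].
  rewrite [q`_ _]nth_default ?mulr0 // (leq_trans szq) //.
  by rewrite ltn_subRL ltn_add2r.
by rewrite nth_default ?mul0r // (leq_trans szp).
Qed.

Lemma coef_comp_polyNX (R : comNzRingType) (p : {poly R}) j :
  (p \Po (- 'X))`_j = (-1) ^+ j * p`_j.
Proof.
rewrite comp_polyE -[in RHS](coefK p) poly_def !coef_sum mulr_sumr.
apply: eq_bigr => i _; rewrite !coefZ (exprNn 'X).
rewrite -polyC1 -polyCN -polyC_exp coefCM coefXn.
by have [->|] := eqVneq j i; rewrite ?mulr1 ?mulr0 // mulrC.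
Qed.

(** Comparing the coefficients of index [N] identifies the scalar [s] as
    [(-1)^N]; at an index of the other parity, it is the wrong sign. *)
Lemma coef_eigen_comp_polyNX (K : fieldType) (p : {poly K}) (s : K) N j :
  2 != 0 :> K -> p \Po (- 'X) = s *: p -> p`_N != 0 -> odd j != odd N ->
  p`_j = 0.
Proof.
move=> K2 pE pN odd_jN.
have coefE i : (-1) ^+ i * p`_i = s * p`_i.
  by rewrite -coef_comp_polyNX pE coefZ.
have /(mulIf pN) sE := coefE N.
move: (coefE j); rewrite -sE -signr_odd -[in RHS]signr_odd.
have -> : odd N = ~~ odd j by move: odd_jN; do 2!case: odd.
rewrite signrN mulNr => /eqP; rewrite -addr_eq0 -mulr2n -mulr_natl.
by rewrite !mulf_eq0 (negPf K2) signr_eq0 /= => /eqP.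
Qed.

(** * The difference operator in the centred variable *)

(** The polynomial [L_n] of the introduction, the indeterminate being [t]. *)
Definition centered_diff {K : fieldType} (h : {poly K}) (delta : K) (n : nat) :=
  (h \Po ('X + delta%:P)) * ('X + (2^-1)%:P) ^+ n
  - (h \Po ('X + (- delta)%:P)) * ('X + (- 2^-1)%:P) ^+ n.

(** The half-integer shift makes [x(k)] and [x(k + 1)] the powers of [t - 1/2]
    and [t + 1/2], which [t -> -t] exchanges up to sign; [gamma] does the same
    for the arguments [k - 1] and [k + alpha] of [b]. *)
Lemma diff_op_centered (K : fieldType) (a b : {poly K}) (alpha beta : K) n
    (gamma := - beta + (alpha - 1) / 2) (delta := (alpha + 1) / 2) :
  2 != 0 :> K -> a = b \Po ('X + alpha%:P) ->
  centered_diff (b \Po (beta%:P + 'X)) delta n \Po ('X + gamma%:P)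
  = diff_op a b (('X + (gamma - 2^-1)%:P) ^+ n).
Proof.
move=> K2 ->; rewrite /centered_diff /diff_op.
rewrite comp_polyB !comp_polyM !rmorphXn /= -!comp_polyA.
rewrite !(comp_polyD, comp_polyX, comp_polyC).
congr ((_ \Po _) * _ ^+ n - (_ \Po _) * _ ^+ n).
- rewrite addrCA -!addrA -!polyCD; congr (_ + _%:P).
  by rewrite /gamma /delta; field.
- by rewrite -!addrA -polyC1 -!polyCD; congr (_ + _%:P); rewrite /gamma; field.
- rewrite -(polyC1 K) -polyCN addrCA -!addrA -!polyCD; congr (_ + _%:P).
  by rewrite /gamma /delta; field.
- by rewrite -addrA -polyCD.
Qed.

(** Both assertions come from the splitting
    [P U - Q V = (P - Q) U + Q (U - V)], whose two differences are central
    ones: relative to the leading coefficient of [h], [(P - Q) U] contributes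
    [2 delta] times the degree and [Q (U - V)] contributes [n].  The bound
    on the degree of [h] is written [d.+1], so that [n = 0] gives degree [d]. *)
Lemma centered_diff_top (K : fieldType) (h : {poly K}) (delta : K) (d n : nat) :
  2 != 0 :> K -> (size h <= d.+2)%N ->
  (size (centered_diff h delta n) <= (d + n).+1)%N /\
  (centered_diff h delta n)`_(d + n)
    = h`_d.+1 * (2 * delta * d.+1%:R + n%:R).
Proof.
move=> K2 szh; rewrite /centered_diff.
set P := h \Po _; set Q := h \Po ('X + (- delta)%:P).
set U := _ ^+ n; set V := _ ^+ n.
have [szPQ PQd] := central_difference _ h delta _ szh.
have szXn : (size ('X^n : {poly K}) <= n.+1)%N by rewrite size_polyXn.
have [] := central_difference _ 'X^n (2^-1 : K) _ szXn.
rewrite !comp_Xn_poly coefXn eqxx mul1r mulfV // mul1r -/U -/V => szUV UVn.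
have szQ : (size Q <= d.+2)%N by apply: size_comp_XaddC.
have szU : (size U <= n.+1)%N by rewrite /U -comp_Xn_poly size_comp_XaddC.
have Qd : Q`_d.+1 = h`_d.+1 by apply: coef_comp_XaddC_top.
have Un : U`_n = 1 by rewrite coef_XaddC_exp subnn binn.
have -> : P * U - Q * V = (P - Q) * U + Q * (U - V) by ring.
split.
  rewrite (leq_trans (size_polyD _ _)) // geq_max.
  apply/andP; split; apply: leq_trans (size_polyMleq _ _) _.
    by rewrite -subn1 leq_subLR (leq_trans (leq_add szPQ szU)) //; lia.
  by rewrite -subn1 leq_subLR (leq_trans (leq_add szQ szUV)) //; lia.
rewrite coefD coefM_top // PQd Un mulr1 [RHS]mulrDr; congr (_ + _).
case: n U V szUV UVn {szXn szU Un} => [|n] U V szUV UVn.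
  by move: szUV; rewrite leqn0 size_poly_eq0 => /eqP->; rewrite !mulr0 coef0.
by rewrite addnS -addSn coefM_top // UVn Qd.
Qed.

Lemma coef_centered_diff_parity (K : fieldType) (h : {poly K}) (e delta : K)
    (n N j : nat) :
  2 != 0 :> K -> h \Po (- 'X) = e *: h ->
  (centered_diff h delta n)`_N != 0 -> odd j != odd N ->
  (centered_diff h delta n)`_j = 0.
Proof.
move=> K2 hE; apply: (@coef_eigen_comp_polyNX _ _ (- e * (-1) ^+ n)) => //.
have reflect c : ('X + c%:P : {poly K}) \Po (- 'X) = - ('X + (- c)%:P).
  by rewrite comp_polyD comp_polyX comp_polyC polyCN opprD opprK.
have reflect_h c :
    (h \Po ('X + c%:P)) \Po (- 'X) = e *: (h \Po ('X + (- c)%:P)).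
  rewrite -comp_polyA reflect -comp_polyZ -hE -comp_polyA; congr (h \Po _).
  by rewrite [RHS]rmorphN /= comp_polyX.
rewrite /centered_diff comp_polyB !comp_polyM !rmorphXn /= !reflect_h !reflect.
rewrite !opprK !(exprNn ('X + _)) -!mul_polyC.
rewrite polyCM (polyCN e) polyC_exp (polyCN 1) polyC1.
by ring.
Qed.

(** * Reduction modulo the difference space *)

Theorem theorem2 (K : fieldType) (charK : [pchar K] =i pred0)
    (a b : {poly K}) (a_neq0 : a != 0) (b_neq0 : b != 0)
    (alpha beta : K)
    (ab : a = b \Po ('X + alpha%:P))
    (b_sym : b \Po (beta%:P + 'X) = b \Po (beta%:P - 'X) \/
             b \Po (beta%:P + 'X) = - (b \Po (beta%:P - 'X)))
    (not_nat : ~ exists n : nat, - (alpha + 1) * ((size a).-1)%:R = n%:R)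
    (gamma : K) (gammaE : gamma = - beta + (alpha - 1) / 2) (m : nat) :
  lspan [set coset a b (('X + gamma%:P) ^+ (2 * i))
          | i in [set i : nat | (2 * i < (size a).-1 - 1)%N]]
        (coset a b (('X + gamma%:P) ^+ (2 * m))) /\
  lspan [set coset a b (('X + gamma%:P) ^+ (2 * i + 1))
          | i in [set i : nat | (2 * i + 1 < (size a).-1 - 1)%N]]
        (coset a b (('X + gamma%:P) ^+ (2 * m + 1))).
Proof.
have K2 : 2 != 0 :> K by rewrite ((pcharf0P K).1 charK).
pose h := b \Po (beta%:P + 'X); pose delta := (alpha + 1) / 2.
have [e h_sym] : exists e : K, h \Po (- 'X) = e *: h.
  have -> : h \Po (- 'X) = b \Po (beta%:P - 'X).
    by rewrite -comp_polyA comp_polyD comp_polyX comp_polyC.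
  by case: b_sym; rewrite /h => ->; [exists 1 | exists (-1)];
    rewrite ?scale1r // scaleN1r opprK.
have szh : size h = size a.
  have sz2 c : size ('X + c%:P : {poly K}) = 2 by rewrite size_XaddC.
  by rewrite ab /h addrC !size_comp_poly2.
have [d sza] : exists d, size a = d.+2.
  (* A nonzero constant [a] is excluded: [-(alpha + 1) * 0] is the natural 0. *)
  case E: (size a) not_nat => [|[|d]] not_nat; last by exists d.
    by move: E a_neq0 => /eqP; rewrite size_poly_eq0 => ->.
  by case: not_nat; exists 0%N; rewrite mulr0.
have hd : h`_d.+1 != 0.
  rewrite -[d.+1]/(d.+2.-1) -sza -szh -lead_coefE lead_coef_eq0.
  by rewrite -size_poly_eq0 szh sza.
rewrite sza /= subn1 /=.
pose f : {linear {poly K} -> diff_quot a b} :=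
  (coset a b \o comp_poly ('X + gamma%:P))%FUN.
have fX j : f 'X^j = coset a b (('X + gamma%:P) ^+ j).
  by rewrite /f /= comp_Xn_poly.
have reduce : forall N,
    lspan [set f 'X^j | j in [set j | (j < d)%N && (odd j == odd N)]] (f 'X^N).
  apply: monomial_parity_reduction => N leDN.
  pose n := (N - d)%N; have NE : N = (d + n)%N by rewrite subnKC.
  have szh_le : (size h <= d.+2)%N by rewrite szh sza.
  have [szL topL] := centered_diff_top _ h delta d n K2 szh_le.
  have topL_neq0 : (centered_diff h delta n)`_N != 0.
    rewrite NE topL mulf_neq0 // [2 * _]mulrC divfK //.
    (* A zero would make [-(alpha + 1)] times the degree equal to [n]. *)
    apply/eqP => top0; apply: not_nat; exists n; rewrite sza /=.
    by apply/eqP; rewrite -subr_eq0 mulNr -opprD top0 oppr0.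
  exists (centered_diff h delta n); split=> //.
  - rewrite /f /= gammaE (diff_op_centered _ _ _ _ _ _ K2 ab).
    rewrite -[RHS](raddf0 (coset a b)); apply/coset_eqP; rewrite subr0.
    by eexists.
  - by rewrite NE.
  - by move=> j; apply: coef_centered_diff_parity h_sym topL_neq0.
rewrite -!fX.
split; apply: lspan_sub (reduce _) => _ [j /andP[ltjd /eqP oddj] <-].
- exists j./2; last by rewrite -fX; congr (f 'X^_); lia.
  by rewrite /=; lia.
- exists j./2; last by rewrite -fX; congr (f 'X^_); lia.
  by rewrite /=; lia.
Qed.
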